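(* For every CSP instance $\mathbf{I}$, it holds that $\mathsf{jw}(\mathbf{I}) \leq \mathsf{fhtw}(\mathbf{I})$, i.e. the joinwidth of $\mathbf{I}$ is at most its fractional hypertree width.
   Context: CSP. A CSP instance $\mathbf{I}=\langle V,D,C\rangle$ consists of a finite set $V$ of variables, a finite domain $D$ and a set $C$ of constraints. A constraint $c$ has a scope $S(c)$ (a totally ordered subset of $V$) and a relation $R(c)\subseteq D^{|S(c)|}$; $|c|$ is the number of tuples in $R(c)$. It is assumed that every variable occurs in the scope of at least one constraint. For $t\in R(c)$ and $v\in S(c)$, $t[v]$ is the entry of $t$ at the position of $v$; $t[V']$ is the restriction of $t$ to the variables in $S(c)\cap V'$. $\sharp_{\mathrm{tup}}(\mathbf{I})$ is the maximum number of tuples in any constraint relation of $\mathbf{I}$. The join $c\bowtie c'$ is the constraint with scope $S(c)\cup S(c')$ (first $S(c)$, then $S(c')\setminus S(c)$) whose tuples are the combinations of $t\in R(c)$ and $t'\in R(c')$ that agree on $S(c)\cap S(c')$. The projection $\pi_{V'}(c)$ has scope $S(c)\cap V'$ and relation $\{t[V'] : t\in R(c)\}$ (so for $S(c)\cap V'=\emptyset$ it contains just the empty tuple if $R(c)\neq\emptyset$, and no tuple otherwise). Join decompositions. A join decomposition for $\mathbf{I}$ is a pair $(J,\varrho)$ where $J$ is a rooted binary tree and $\varrho$ is a bijection between the leaves of $J$ and $C$. For a node $j$ of $J$, let $X(j)$ be the set of constraints $\varrho(\ell)$ over leaves $\ell$ of the subtree rooted at $j$, $V(j)=\bigcup_{c\in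 X(j)}S(c)$ and $\overline{V}(j)=\bigcup_{c\in C\setminus X(j)}S(c)$. Define $C_{proj}(j)=\pi_{\overline{V}(j)}(\varrho(j))$ if $j$ is a leaf, and $C_{proj}(j)=\pi_{\overline{V}(j)}(C_{proj}(j_1)\bowtie C_{proj}(j_2))$ if $j$ has children $j_1,j_2$. For a constraint $c$, $\mathsf{prune}(c)$ is obtained from $c$ by removing all tuples $t\in R(c)$ for which there is a constraint $c'\in C$ with $t[S(c')]\notin \pi_{S(c)}(c')$. Set $C(j)=\mathsf{prune}(C_{proj}(j))$. The joinwidth $\mathsf{jw}(j)$ of $j$ is the smallest real $\omega$ with $|C(j)|\leq (\sharp_{\mathrm{tup}}(\mathbf{I}))^{\omega}$, i.e. $\log_{\sharp_{\mathrm{tup}}(\mathbf{I})}|C(j)|$. The width (joinwidth) of a join decomposition is the maximum of $\mathsf{jw}(j)$ over its nodes (so width at most $\omega$ means $|C(j)|\le(\sharp_{\mathrm{tup}}(\mathbf{I}))^\omega$ for all nodes $j$), and $\mathsf{jw}(\mathbf{I})$ is the minimum width over all join decompositions of $\mathbf{I}$. Fractional hypertree width. The hypergraph $H(\mathbf{I})$ has vertex set $V$ and edge set $\{S(c): c\in C\}$ (scopes as unordered sets). For a hypergraph $H$ and $V'\subseteq V(H)$, $H[V']$ has vertex set $V'$ and edges $\{e\cap V' : e\in E(H)\}$. A fractional edge cover of $H$ is a mapping $\gamma:E(H)\to\mathbb{R}_{\geq 0}$ with $\sum_{e\in E(H), v\in e}\gamma(e)\geq 1$ for every $v\in V(H)$;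 its weight is $\sum_{e\in E(H)}\gamma(e)$. A fractional hypertree decomposition of $H$ is a triple $(T,(B_t)_{t\in V(T)},(\gamma_t)_{t\in V(T)})$ where $(T,(B_t)_t)$ is a tree decomposition of $H$ (every hyperedge is contained in some bag, and for each vertex the nodes whose bags contain it induce a non-empty subtree) and each $\gamma_t$ is a mapping from $E(H)$ to $\mathbb{R}_{\ge 0}$ that is a fractional edge cover for $H[B_t]$, i.e. $\sum_{e\in E(H),v\in e}\gamma_t(e)\ge 1$ for every $v\in B_t$. Its width is the maximum weight of $\gamma_t$ over $t\in V(T)$. $\mathsf{fhtw}(H)$ is the minimum width of any fractional hypertree decomposition of $H$, and $\mathsf{fhtw}(\mathbf{I})=\mathsf{fhtw}(H(\mathbf{I}))$. *)

(* Defs.v *)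
From HB Require Import structures.
From mathcomp Require Import all_boot all_order all_algebra finmap.
From mathcomp Require Import all_classical all_reals all_analysis.

Set Implicit Arguments.
Unset Strict Implicit.
Unset Printing Implicit Defensive.

Import Order.TTheory GRing.Theory Num.Theory.
Local Open Scope ring_scope.

Section CSP.
Variables V D : finType.

(* The scope is a duplicate-free sequence, i.e. a totally ordered subset of V,
   and the relation is a set of tuples indexed by the positions of the scope. *)
Record constraint := Constraint {
  cbody : {s : seq V & {set (size s).-tuple D}};
  _ : uniq (tag cbody) }.

HB.instance Definition _ := [isSub for cbody].
HB.instance Definition _ := [Choice of constraint by <:].

Definition scope (c : constraint) : seq V := tag (cbody c).

Definition rel_of (c : constraint) : {set (size (scope c)).-tuple D} :=
  tagged (cbody c).

Lemma scope_uniq (c : constraint) : uniq (scope c).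
Proof. by case: c. Qed.

Definition mk_constraint (s : seq V) (us : uniq s)
  (r : {set (size s).-tuple D}) : constraint :=
  @Constraint (Tagged (fun s : seq V => {set (size s).-tuple D}) r) us.

Definition scope_set (c : constraint) : {set V} := [set v in scope c].

(* t[v] for a tuple t over the scope s; it is None exactly when v is not in s
   (the domain D may be empty, so there is no default value). *)
Definition entry (s : seq V) (t : seq D) (v : V) : option D :=
  onth t (index v s).

Definition restrict_tuple (s : seq V) (t : seq D) (A : {set V}) : seq D :=
  mask [seq v \in A | v <- s] t.

Definition agree (s : seq V) (t : seq D) (s' : seq V) (t' : seq D) : bool :=
  [forall v, (v \in s) && (v \in s') ==> (entry s t v == entry s' t' v)].

Definition join_scope (c c' : constraint) : seq V :=
  scope c ++ [seq v <- scope c' | v \notin scope_set c].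

Lemma join_scope_uniq (c c' : constraint) : uniq (join_scope c c').
Proof.
rewrite cat_uniq scope_uniq filter_uniq ?scope_uniq // andbT.
by apply/hasPn => v; rewrite mem_filter inE => /andP[].
Qed.

Definition natural_join (c c' : constraint) : constraint :=
  mk_constraint (join_scope_uniq c c')
    [set t : (size (join_scope c c')).-tuple D |
      [exists u in rel_of c, exists u' in rel_of c',
        agree (scope c) u (scope c') u' &&
        (val t == val u ++ restrict_tuple (scope c') u' (~: scope_set c))]].

Definition proj_scope (A : {set V}) (c : constraint) : seq V :=
  [seq v <- scope c | v \in A].

Lemma proj_scope_uniq (A : {set V}) (c : constraint) : uniq (proj_scope A c).
Proof. exact/filter_uniq/scope_uniq. Qed.

Definition projection (A : {set V}) (c : constraint) : constraint :=
  mk_constraint (proj_scope_uniq A c)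
    [set t : (size (proj_scope A c)).-tuple D |
      [exists u in rel_of c, val t == restrict_tuple (scope c) u A]].

Record csp := Csp {
  constraints : {fset constraint};
  constraints_cover : forall v : V, exists2 c, c \in constraints & v \in scope c }.

Definition max_tuples (I : csp) : nat :=
  \max_(c <- constraints I) #|rel_of c|.

(* A tuple t is kept when, for every constraint c', the restriction t[S(c')] is
   a tuple of the projection of c' to S(c).  The two scopes may order their
   common variables differently, so membership is up to this reordering: the
   tuples are compared as assignments of the variables in S(c) and S(c'). *)
Definition prune (I : csp) (c : constraint) : constraint :=
  mk_constraint (scope_uniq c)
    [set t in rel_of c |
      all (fun c' => let p := projection (scope_set c) c' in
             [exists u in rel_of p, agree (scope c) t (scope p) u])
          (constraints I)].

(* A rooted binary tree whose leaves carry their image under the bijection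
   with the constraints. *)
Inductive join_tree :=
  | JLeaf of constraint
  | JNode of join_tree & join_tree.

Fixpoint leaves (J : join_tree) : seq constraint :=
  match J with
  | JLeaf c => [:: c]
  | JNode J1 J2 => leaves J1 ++ leaves J2
  end.

(* The nodes of J, each given by the subtree rooted at it. *)
Fixpoint nodes (J : join_tree) : seq join_tree :=
  match J with
  | JLeaf _ => [:: J]
  | JNode J1 J2 => J :: nodes J1 ++ nodes J2
  end.

Definition join_decomposition (I : csp) (J : join_tree) : Prop :=
  uniq (leaves J) /\ leaves J =i constraints I.

Definition outer_vars (I : csp) (j : join_tree) : {set V} :=
  [set v | has (fun c => (c \notin leaves j) && (v \in scope c))
               (constraints I)].

Fixpoint cproj (I : csp) (j : join_tree) : constraint :=
  match j with
  | JLeaf c => projection (outer_vars I j) c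
  | JNode j1 j2 =>
      projection (outer_vars I j) (natural_join (cproj I j1) (cproj I j2))
  end.

Definition node_constraint (I : csp) (j : join_tree) : constraint :=
  prune I (cproj I j).

Definition hyperedges (I : csp) : {set {set V}} :=
  [set e | has (fun c => e == scope_set c) (constraints I)].

Section Widths.
Variable R : realType.

(* The infimum is taken in the extended reals, so that it is also defined when
   there is no least real: it is then -oo, which happens exactly if the node
   constraint is empty or all relations have at most one tuple. *)
Definition node_joinwidth (I : csp) (j : join_tree) : \bar R :=
  ereal_inf [set w%:E | w in
    [set w : R | (#|rel_of (node_constraint I j)|%:R
                   <= (max_tuples I)%:R `^ w)%R]]%classic.

Definition decomposition_joinwidth (I : csp) (J : join_tree) : \bar R :=
  \big[maxe/-oo%E]_(j <- nodes J) node_joinwidth I j.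

Definition joinwidth (I : csp) : \bar R :=
  ereal_inf [set decomposition_joinwidth I J | J in
    [set J | join_decomposition I J]]%classic.

End Widths.
End CSP.

Definition induced_adj (T : finType) (adj : rel T) (A : {set T}) : rel T :=
  [rel x y | [&& x \in A, y \in A & adj x y]].

(* The subgraph induced by A is a tree: non-empty, connected, and without
   simple cycle of length at least 3. *)
Definition induces_tree (T : finType) (adj : rel T) (A : {set T}) : Prop :=
  [/\ exists x, x \in A,
      {in A &, forall x y, connect (induced_adj adj A) x y} &
      forall p : seq T, ucycle (induced_adj adj A) p -> (size p <= 2)%N].

Section Hypergraph.
Variables (R : realType) (V : finType).

(* A hypergraph with vertex set V is given by its set E of edges.  Only the
   values of each fhd_cover t on E are relevant. *)
Record fhd (E : {set {set V}}) := Fhd {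
  fhd_node : finType;
  fhd_adj : rel fhd_node;
  fhd_bag : fhd_node -> {set V};
  fhd_cover : fhd_node -> {set V} -> R;
  fhd_adj_sym : symmetric fhd_adj;
  fhd_adj_irr : irreflexive fhd_adj;
  fhd_tree : induces_tree fhd_adj [set: fhd_node]%SET;
  fhd_edge : forall e, e \in E -> exists t, e \subset fhd_bag t;
  fhd_vertex : forall v, induces_tree fhd_adj [set t | v \in fhd_bag t];
  fhd_cover_ge0 : forall t e, e \in E -> 0 <= fhd_cover t e;
  fhd_coverP : forall t v, v \in fhd_bag t ->
    1 <= \sum_(e in E | v \in e) fhd_cover t e }.

Definition fhd_width (E : {set {set V}}) (d : fhd E) : \bar R :=
  \big[maxe/-oo%E]_(t : fhd_node d) (\sum_(e in E) fhd_cover t e)%:E.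

Definition hypergraph_fhtw (E : {set {set V}}) : \bar R :=
  ereal_inf [set w | exists d : fhd E, fhd_width d = w]%classic.

End Hypergraph.

Definition fhtw (R : realType) (V D : finType) (I : csp V D) : \bar R :=
  hypergraph_fhtw R (hyperedges I).

(* Main.v *)
Require Import Defs.
From HB Require Import structures.
From mathcomp Require Import all_boot all_order all_algebra finmap.
From mathcomp Require Import all_classical all_reals all_analysis.

(* Assign every constraint to a tree node whose bag contains its scope, and
   eliminate the tree nodes leaf by leaf, joining all partial join trees held by
   the eliminated node and passing the result to its neighbour.  Every scope
   V(j) & \overline{V}(j) arising this way lies in a single bag B_t.  The tuples
   left by pruning at j project, on each hyperedge, into the relation of an input
   constraint, so the fractional cover of B_t bounds their number by the
   Atserias-Grohe-Marx inequality |A| <= prod_e |proj_e A| ^ gamma(e); this is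
   proved by slicing along one variable at a time, with Hoelder's inequality for
   the exponents of the edges containing that variable. *)

Set Implicit Arguments.
Unset Strict Implicit.
Unset Printing Implicit Defensive.

Import Order.TTheory GRing.Theory Num.Theory.
Local Open Scope ring_scope.

(** * Weighted means, Hölder's inequality and the product bound by projections *)

Section Inequalities.
Variable R : realType.

Lemma powR_le_expR (x g : R) : 0 <= x -> 0 <= g -> x `^ g <= expR (g * (x - 1)).
Proof.
move=> x0 g0; rewrite mulrC expRM; apply: ge0_ler_powR => //.
- by rewrite nnegrE expR_ge0.
- by have := expR_ge1Dx (x - 1); rewrite addrC subrK.
Qed.

Lemma powR_prod (I : finType) (P : pred I) (w : I -> R) (x : R) :
  0 < x -> \prod_(i | P i) x `^ w i = x `^ (\sum_(i | P i) w i).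
Proof.
move=> x0; elim/big_rec2: _ => [|i y s _ ->]; first by rewrite powRr0.
by rewrite powRD // (gt_eqF x0) implybT.
Qed.

(** After division by the mean [S], each factor is at most [expR (w i * (x i / S - 1))], and these
    exponents sum to zero. *)
Lemma weighted_AGM (I : finType) (P : pred I) (w x : I -> R) :
  (forall i, P i -> 0 <= w i) -> (forall i, P i -> 0 <= x i) ->
  \sum_(i | P i) w i = 1 ->
  \prod_(i | P i) x i `^ w i <= \sum_(i | P i) w i * x i.
Proof.
move=> w0 x0 w1; set S := \sum_(i | P i) w i * x i.
have wx0 i : P i -> 0 <= w i * x i by move=> Pi; rewrite mulr_ge0 ?w0 ?x0.
have S_ge0 : 0 <= S by exact: sumr_ge0.
have [S0|S_neq0] := eqVneq S 0.
  (* The weights sum to 1, so some [w i] is nonzero; a zero mean then forces [x i = 0], which kills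
     the product. *)
  have [i /andP[Pi wi0]|w_eq0] := pickP (fun i => P i && (w i != 0)); last first.
    have: \sum_(i | P i) w i = 0.
      by apply: big1 => i Pi; have := w_eq0 i; rewrite Pi => /negbFE/eqP.
    by move/eqP; rewrite w1 oner_eq0.
  have /eqP := S0; rewrite psumr_eq0 // => /allP/(_ i (mem_index_enum i)).
  rewrite Pi mulf_eq0 (negbTE wi0) => /eqP xi0.
  by rewrite (bigD1 i) //= xi0 powR0 // mul0r.
have S_gt0 : 0 < S by rewrite lt_def S_neq0.
have -> : \prod_(i | P i) x i `^ w i = S * \prod_(i | P i) (x i / S) `^ w i.
  rewrite -[X in X * _]powRr1 // -[X in S `^ X]w1 -powR_prod // -big_split /=.
  apply: eq_bigr => i Pi.
  by rewrite -powRM ?divr_ge0 ?x0 // mulrC divfK.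
rewrite ger_pMr //.
have exp1 : expR (\sum_(i | P i) w i * (x i / S - 1)) = 1.
  under eq_bigr do rewrite mulrBr mulr1 mulrA.
  by rewrite sumrB w1 -mulr_suml divff // subrr expR0.
rewrite -[leRHS]exp1 expR_sum; apply: ler_prod => i Pi.
by rewrite powR_ge0 powR_le_expR ?w0 // divr_ge0 ?x0.
Qed.

(** Normalising each [a i] by its sum puts all values in the unit interval. There the exponents may
    be lowered from [g i] to [g i / G], with sum 1, and the weighted mean inequality applies for
    each [d]. *)
Lemma holder_sum_prod (I T : finType) (P : pred I) (g : I -> R)
    (a : I -> T -> R) :
  (forall i, P i -> 0 <= g i) -> (forall i d, 0 <= a i d) ->
  1 <= \sum_(i | P i) g i ->
  \sum_d \prod_(i | P i) a i d `^ g i <=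
  \prod_(i | P i) (\sum_d a i d) `^ g i.
Proof.
move=> g0 a0; set G := \sum_(i | P i) g i => G1.
have G_gt0 : 0 < G by exact: lt_le_trans G1.
pose s i := \sum_d a i d.
have s0 i : 0 <= s i by exact: sumr_ge0.
pose b i d := a i d / s i.
have b0 i d : 0 <= b i d by rewrite divr_ge0.
have as_ i d : a i d <= s i by rewrite /s (bigD1 d) //= lerDl sumr_ge0.
have aE i d : a i d = s i * b i d.
  have [si0|si0] := eqVneq (s i) 0; last by rewrite /b mulrC divfK.
  by apply/eqP; rewrite si0 mul0r eq_le a0 -si0 as_.
have sb i : \sum_d b i d <= 1.
  rewrite -mulr_suml -/(s i).
  by have [->|si0] := eqVneq (s i) 0; rewrite ?mul0r ?divff ?ler01.
have b1 i d : b i d <= 1.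
  by apply: le_trans (sb i); rewrite (bigD1 d) //= lerDl sumr_ge0.
have -> : \sum_d \prod_(i | P i) a i d `^ g i =
    (\prod_(i | P i) s i `^ g i) * \sum_d \prod_(i | P i) b i d `^ g i.
  rewrite mulr_sumr; apply: eq_bigr => d _.
  by rewrite -big_split; apply: eq_bigr => i Pi; rewrite aE powRM.
rewrite -[leRHS]mulr1; apply: ler_wpM2l.
  by apply: prodr_ge0 => i _; exact: powR_ge0.
have w0 i : P i -> 0 <= g i / G by move=> Pi; rewrite divr_ge0 ?g0 // ltW.
have w1 : \sum_(i | P i) g i / G = 1.
  by rewrite -mulr_suml divff // gt_eqF.
apply: (@le_trans _ _ (\sum_d \sum_(i | P i) g i / G * b i d)).
  apply: ler_sum => d _; apply: le_trans (weighted_AGM w0 _ w1); last by [].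
  apply: ler_prod => i Pi; rewrite powR_ge0 /=.
  (* Base zero is separate because its power jumps to 1 at exponent 0. *)
  have [bi0|bi0] := eqVneq (b i d) 0.
    have [gi0|gi0] := eqVneq (g i) 0; first by rewrite gi0 mul0r.
    by rewrite bi0 powR0 ?powR_ge0.
  apply: ger_powR; first by rewrite lt_def bi0 b0 b1.
  by rewrite ler_pdivrMr // ler_peMr ?g0.
rewrite exchange_big /= -w1; apply: ler_sum => i Pi.
by rewrite -mulr_sumr -[leRHS]mulr1 ler_wpM2l ?w0.
Qed.

Section ProductBound.
Variables V K : finType.

(** The value [None] outside [e] keeps the projections to all edges in one type. *)
Definition proj_ffun (e : {set V}) (a : {ffun V -> K}) : {ffun V -> option K} :=
  [ffun v => if v \in e then Some (a v) else None].

Definition slice (A : {set {ffun V -> K}}) (v : V) (d : K) :=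
  [set a in A | a v == d].

Lemma card_slice (A : {set {ffun V -> K}}) (v : V) :
  #|A| = (\sum_d #|slice A v d|)%N.
Proof.
rewrite -sum1_card (partition_big (fun a : {ffun V -> K} => a v) xpredT) //=.
by apply: eq_bigr => d _; rewrite -sum1_card; apply: eq_bigl => a; rewrite inE.
Qed.

Lemma proj_slice_sub (A : {set {ffun V -> K}}) (v : V) (d : K) (e : {set V}) :
  proj_ffun e @: slice A v d \subset proj_ffun e @: A.
Proof. by apply/imsetS/fintype.subsetP => a; rewrite inE => /andP[]. Qed.

(** Since [v] lies in [e], a projected point still shows its value at [v], so distinct slices have
    disjoint projections. *)
Lemma sum_card_proj_slice (A : {set {ffun V -> K}}) (v : V) (e : {set V}) :
  v \in e ->
  (\sum_d #|proj_ffun e @: slice A v d| <= #|proj_ffun e @: A|)%N.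
Proof.
move=> ve; set B := proj_ffun e @: A.
rewrite -[X in (_ <= X)%N]sum1_card.
under eq_bigr do rewrite -sum1_card.
rewrite (exchange_big_dep (mem B)) /=; last first.
  by move=> d b _ bd; exact: (fintype.subsetP (proj_slice_sub A v d e) _ bd).
apply: leq_sum => b bB; rewrite sum1_card.
apply/card_le1_eqP => d d' /imsetP[a ad ->] /imsetP[a' ad' eq_b].
move: ad ad'; rewrite !inE => /andP[_ /eqP <-] /andP[_ /eqP <-].
by have /ffunP/(_ v) := eq_b; rewrite !ffunE ve => -[].
Qed.

(** Allowing uncovered coordinates that are constant on [A] serves two ends: slicing creates such
    coordinates, and so do variables outside a scope, whose entry is always [None]. *)
Lemma card_le_prod_proj (E : {set {set V}}) (g : {set V} -> R)
    (A : {set {ffun V -> K}}) :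
  (forall e, e \in E -> 0 <= g e) ->
  (forall v, {in A &, forall a b : {ffun V -> K}, a v = b v} \/
             1 <= \sum_(e in E | v \in e) g e) ->
  #|A|%:R <= \prod_(e in E) #|proj_ffun e @: A|%:R `^ g e.
Proof.
move=> g0 cover.
(* Induction on the list [s] of coordinates still to be sliced; all others are already constant. *)
suff gen (s : seq V) : (forall v, v \notin s -> {in A &, forall a b : {ffun V -> K}, a v = b v}) ->
    (forall v, v \in s -> 1 <= \sum_(e in E | v \in e) g e) ->
    #|A|%:R <= \prod_(e in E) #|proj_ffun e @: A|%:R `^ g e.
  apply: (gen [seq v <- enum V | 1 <= \sum_(e in E | v \in e) g e]).
    move=> v; rewrite mem_filter mem_enum andbT => /negP nv.
    by case: (cover v).
  by move=> v; rewrite mem_filter => /andP[].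
elim: s A {cover} => [|v s IHs] A cst cov.
  have [->|[a aA]] := set_0Vmem A.
    by rewrite cards0 prodr_ge0 // => e _; exact: powR_ge0.
  have -> : A = [set a].
    apply/setP => b; rewrite inE; apply/idP/eqP => [bA|-> //].
    by apply/ffunP => v; exact: cst.
  rewrite cards1 big1 // => e _.
  by rewrite imset_set1 cards1 powR1.
have vE : 1 <= \sum_(e in E | v \in e) g e by apply: cov; rewrite mem_head.
rewrite (card_slice A v) natr_sum.
pose n e d : R := #|proj_ffun e @: slice A v d|%:R.
apply: (@le_trans _ _ (\sum_d \prod_(e in E) n e d `^ g e)).
  apply: ler_sum => d _; apply: IHs => w ws.
    move=> a b; rewrite !inE => /andP[aA /eqP av] /andP[bA /eqP bv].
    have [->|wv] := eqVneq w v; first by rewrite av bv.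
    by apply: cst => //; rewrite inE negb_or wv.
  by apply: cov; rewrite inE ws orbT.
have split_prod (F : {set V} -> R) : \prod_(e in E) F e =
    \prod_(e in E | v \in e) F e * \prod_(e in E | v \notin e) F e.
  exact: bigID.
pose N e : R := #|proj_ffun e @: A|%:R.
rewrite -/(N _).
(* Edges avoiding [v] get the projection of all of [A] as a bound, which leaves the sum; Hölder
   handles the edges through [v]. *)
apply: (@le_trans _ _ (\sum_d (\prod_(e in E | v \in e) n e d `^ g e) *
    \prod_(e in E | v \notin e) N e `^ g e)).
  apply: ler_sum => d _; rewrite split_prod; apply: ler_wpM2l.
    by apply: prodr_ge0 => e _; exact: powR_ge0.
  apply: ler_prod => e /andP[eE _]; rewrite powR_ge0 /=.
  by apply: ge0_ler_powR; rewrite ?g0 ?nnegrE // ler_nat subset_leq_card ?proj_slice_sub.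
rewrite -mulr_suml split_prod; apply: ler_wpM2r.
  by apply: prodr_ge0 => e _; exact: powR_ge0.
apply: le_trans (holder_sum_prod _ _ vE) _ => //.
  by move=> e /andP[eE _]; exact: g0.
apply: ler_prod => e /andP[eE ve]; rewrite powR_ge0 /=.
by apply: ge0_ler_powR; rewrite ?g0 ?nnegrE ?sumr_ge0 // -natr_sum ler_nat sum_card_proj_slice.
Qed.

End ProductBound.
End Inequalities.

(** * Size of a pruned constraint whose scope is fractionally covered *)

Section NodeBound.
Variables (R : realType) (V D : finType).

Definition assignment (s : seq V) (t : seq D) : {ffun V -> option D} :=
  [ffun v => entry s t v].

Lemma entry_notin (s : seq V) (t : seq D) (v : V) :
  size t = size s -> v \notin s -> entry s t v = None.
Proof. by move=> st vs; rewrite /entry memNindex // onthE nth_default // size_map st. Qed.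

Lemma assignment_inj (s : seq V) (us : uniq s) :
  injective (fun t : (size s).-tuple D => assignment s t).
Proof.
move=> t t' /ffunP tt'; apply/val_inj/eq_from_onth => i.
have [lt_is|le_si] := ltnP i (size s); last first.
  by rewrite !onthE !nth_default // size_map size_tuple.
have [v _] : exists v : V, True by case: (s) lt_is => // v; exists v.
by have := tt' (nth v s i); rewrite !ffunE /entry index_uniq.
Qed.

(** Pruning gives each surviving tuple a witness [w] in [c'] that agrees with it on the common
    variables, and [f] recovers the projected assignment from [w]. Off the scope of [c] both sides
    are [None]. *)
Lemma card_proj_prune (I : csp V D) (c c' : constraint V D) :
  c' \in constraints I ->
  (#|proj_ffun (scope_set c') @: [set assignment (scope c) (val t) | t in rel_of (prune I c)]|
     <= #|rel_of c'|)%N.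
Proof.
move=> c'I; set p := projection (scope_set c) c'.
pose f (w : (size (scope c')).-tuple D) := proj_ffun (scope_set c')
  (assignment (scope p) (restrict_tuple (scope c') w (scope_set c))).
apply: leq_trans (leq_imset_card f _); apply/subset_leq_card/fintype.subsetP.
move=> _ /imsetP[_ /imsetP[t + ->] ->].
rewrite inE => /andP[_ /allP/(_ _ c'I)/existsP[u /andP[]]].
rewrite inE => /existsP[w /andP[wc' /eqP uw]] /forallP agr.
apply/imsetP; exists w => //; apply/ffunP => v; rewrite !ffunE inE.
case: ifP => // vc'; congr Some; rewrite -uw.
have := agr v; rewrite mem_filter vc' inE andbT andbb => /implyP agrv.
have [vc|vc] := boolP (v \in scope c); first exact/eqP/agrv.
by rewrite !entry_notin ?size_tuple // mem_filter inE (negbTE vc).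
Qed.

Lemma card_prune_le (I : csp V D) (c : constraint V D) (g : {set V} -> R) :
  (exists c, c \in constraints I) ->
  (forall e, e \in hyperedges I -> 0 <= g e) ->
  (forall v, v \in scope c -> 1 <= \sum_(e in hyperedges I | v \in e) g e) ->
  #|rel_of (prune I c)|%:R <=
    (max_tuples I)%:R `^ (\sum_(e in hyperedges I) g e) :> R.
Proof.
move=> [c0 c0I] g0 cov.
have le_max c' : c' \in constraints I -> (#|rel_of c'| <= max_tuples I)%N.
  by move=> c'I; exact: leq_bigmax_seq.
pose A := [set assignment (scope c) (val t) | t in rel_of (prune I c)].
have <- : #|A| = #|rel_of (prune I c)|.
  by rewrite card_imset //; exact/assignment_inj/scope_uniq.
have AN : forall e, e \in hyperedges I -> (#|proj_ffun e @: A| <= max_tuples I)%N.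
  move=> e; rewrite inE => /hasP[c' c'I /eqP ->].
  exact: leq_trans (card_proj_prune _ c'I) (le_max _ c'I).
(* [powR_prod] needs a positive base. If all relations are empty, the projection of [A] to the scope
   of [c0] is empty, hence so is [A]. *)
have [N0|N_gt0] := posnP (max_tuples I).
  have e0 : scope_set c0 \in hyperedges I by rewrite inE; apply/hasP; exists c0.
  have := AN _ e0; rewrite N0 leqn0 cards_eq0 imset_eq0 => /eqP ->.
  by rewrite cards0 powR_ge0.
have N_gt0R : 0 < (max_tuples I)%:R :> R by rewrite ltr0n.
apply: (@le_trans _ _ (\prod_(e in hyperedges I) #|proj_ffun e @: A|%:R `^ g e)).
  apply: card_le_prod_proj => // v.
  have [vc|vc] := boolP (v \in scope c); [by right; exact: cov|left].
  move=> _ _ /imsetP[t _ ->] /imsetP[t' _ ->].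
  by rewrite !ffunE !entry_notin ?size_tuple.
rewrite -powR_prod //; apply: ler_prod => e eI; rewrite powR_ge0 /=.
by apply: ge0_ler_powR; rewrite ?g0 ?nnegrE // ler_nat AN.
Qed.

End NodeBound.

(** * Connected node sets in a tree *)

Section TreeOrder.
Variable (T : finType) (adj : rel T).
Hypothesis adj_sym : symmetric adj.
Hypothesis tree : induces_tree adj [set: T].

Lemma induced_path (A : {set T}) x y : connect (induced_adj adj A) x y -> x \in A ->
  exists p, [/\ path adj x p, last x p = y, uniq (x :: p) & {subset x :: p <= A}].
Proof.
move=> /connectP[p0 p0P ->] xA; case/shortenP: p0P => p pP up _.
exists p; split=> //; first by apply: sub_path pP => u v /and3P[].
move=> z; rewrite inE => /predU1P[-> //|]; move: pP {up} xA.
elim: p x => // w p IHp x /= /andP[/and3P[_ wA _] wp] _.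
by rewrite inE => /predU1P[-> //|]; exact: IHp wp wA.
Qed.

(* Otherwise a path in B from x to s, which avoids y, cut where it first meets A
   and continued inside A to y, would close a cycle through the edge xy. *)
Lemma tree_separation (A B : {set T}) (x y s : T) :
  {in A &, forall u v, connect (induced_adj adj A) u v} ->
  {in B &, forall u v, connect (induced_adj adj B) u v} ->
  x \notin A -> y \in A -> adj x y -> x \in B -> s \in B -> s \in A -> y \in B.
Proof.
move=> conA conB xA yA xy xB sB sA.
have [p [pP lp up pB]] := induced_path (conB _ _ xB sB) xB.
apply: contraT => yB.
have hasA : has (mem A) p.
  have: s \in x :: p by rewrite -lp mem_last.
  rewrite inE => /predU1P[sx|sp]; first by rewrite -sx sA in xA.
  by apply/hasP; exists s.
case/split_find: hasA pP up pB {lp} => z p1 p2 zA p1A.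
rewrite -cats1 -catA cat_path -cat_cons cat_uniq /= => /and3P[p1P zp1 _].
case/and3P=> /andP[xp1 up1] /norP[zxp1 _] _ pB.
have zB : z \in B by apply: pB; rewrite inE mem_cat inE eqxx !orbT.
have [q [qP lq uq qA]] := induced_path (conA _ _ zA yA) zA.
have zy : z != y by apply: contraNneq yB => <-.
(* As [z] differs from [y], [q] is non-empty and the cycle has at least three vertices. It is simple
   because [x] and [p1] avoid [A] while [z :: q] stays in [A]. *)
have [_ _ /(_ (x :: p1 ++ z :: q))] := tree.
case: q => [|w q] in qP lq uq qA *; first by rewrite /= in lq; rewrite lq eqxx in zy.
rewrite /= size_cat /= !addnS => acyc; suff: false by [].
have := acyc _; apply; apply/andP; split; last first.
  rewrite -cat_cons cat_uniq uq andbT; apply/andP; split; first by rewrite /= xp1.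
  apply/hasPn => u uq1; apply/negP => ux.
  have uA := qA _ uq1; move: ux; rewrite inE => /predU1P[ux|up1'].
    by rewrite -ux uA in xA.
  by move/hasPn: p1A => /(_ _ up1'); rewrite /= uA.
rewrite /cycle rcons_path.
have -> : last x (p1 ++ z :: w :: q) = y by rewrite last_cat.
have lift u r : path adj u r -> path (induced_adj adj [set: T]) u r.
  by apply: sub_path => ? ?; rewrite /induced_adj /= !inE.
rewrite lift ?cat_path ?p1P /= ?zp1 //.
by rewrite /induced_adj /= !inE adj_sym.
Qed.

Lemma connect_crossing (A : {set T}) (e : rel T) x y :
  connect e x y -> x \in A -> y \notin A ->
  exists u v, [/\ u \in A, v \notin A & e u v].
Proof.
move=> /connectP[p pP ->]; elim: p x pP => [|w p IHp] x /= => [_ -> //|].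
move=> /andP[xw wp] xA yA; have [wA|wA] := boolP (w \in A); first exact: IHp yA.
by exists x, w.
Qed.

Lemma induced_connect_grow (A : {set T}) x y :
  {in A &, forall u v, connect (induced_adj adj A) u v} -> y \in A -> adj x y ->
  {in x |: A &, forall u v, connect (induced_adj adj (x |: A)) u v}.
Proof.
move=> conA yA xy.
have con_y u : u \in x |: A -> connect (induced_adj adj (x |: A)) u y.
  rewrite in_setU1 => /predU1P[->|uA].
    by apply: connect1; rewrite /induced_adj /= setU11 setU1r.
  apply: connect_sub (conA _ _ uA yA) => a b /and3P[aA bA ab].
  by apply: connect1; rewrite /induced_adj /= !setU1r.
have sym : connect_sym (induced_adj adj (x |: A)).
  by apply: sym_connect_sym => a b; rewrite /induced_adj /= adj_sym andbCA.
move=> u v uA vA; apply: connect_trans (con_y _ uA) _.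
by rewrite sym con_y.
Qed.

End TreeOrder.

(** * Elimination orders of the bags *)

Section RunningIntersection.
Variable V : finType.

(** The running intersection property, with the head eliminated first: [X] plays the bag of a leaf
    and [Y] that of its neighbour among the remaining nodes. *)
Fixpoint running_intersection (s : seq {set V}) : Prop :=
  match s with
  | [::] => True
  | X :: s' => running_intersection s' /\
      (s' = [::] \/
       exists2 Y, Y \in s' & forall Z, Z \in s' -> X :&: Z \subset Y)
  end.

(** The list is built backwards: a connected set of nodes grows from [r], each new node [x] being
    adjacent to some listed [y] and put in front. *)
Lemma tree_running_intersection (T : finType) (adj : rel T) (bag : T -> {set V}) :
  symmetric adj -> induces_tree adj [set: T] ->
  (forall v, induces_tree adj [set t | v \in bag t]) ->
  exists s : seq T, running_intersection (map bag s) /\ forall t, t \in s.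
Proof.
move=> adj_sym tree bag_tree; have [[r _] con _] := tree.
suff grow k : (k < #|T|)%N -> exists s : seq T,
    [/\ size s = k.+1, uniq s, running_intersection (map bag s) &
      {in [set t in s] &, forall u v, connect (induced_adj adj [set t in s]) u v}].
  have T_gt0 : (0 < #|T|)%N by apply/card_gt0P; exists r.
  have [|s [ss us rs _]] := grow #|T|.-1; first by rewrite prednK.
  have [||_ sT] := @uniq_min_size _ s (enum T) us.
  - by move=> t _; rewrite mem_enum.
  - by rewrite ss prednK // -cardE.
  by exists s; split=> // t; rewrite sT mem_enum.
elim: k => [|k IHk] kT.
  exists [:: r]; split=> //=; first by split=> //; left.
  by move=> u v; rewrite !inE => /eqP-> /eqP->; exact: connect0.
have [s [ss us rs cs]] := IHk (ltnW kT).
have [x0 x0s] : exists x0, x0 \in s by case: (s) ss => // x0 ? _; exists x0; exact: mem_head.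
have [w ws] : exists w, w \notin [set t in s].
  apply/existsP; rewrite -negb_forall; apply: contraL kT => /forallP sT.
  rewrite -leqNgt -ss -(card_uniqP us) -cardsE; apply/subset_leq_card/fintype.subsetP => t _.
  by have := sT t; rewrite inE.
have [y [x [ys xs yx]]] : exists y x, [/\ y \in [set t in s], x \notin [set t in s]
    & induced_adj adj [set: T] y x].
  by apply: connect_crossing (con x0 w _ _) _ ws; rewrite ?inE.
have xy : adj x y by move: yx; rewrite /induced_adj /= !inE adj_sym.
exists (x :: s); split => /=.
- by rewrite ss.
- by rewrite us andbT; move: xs; rewrite inE.
- split=> //; right; exists (bag y); first by apply: map_f; move: ys; rewrite inE.
  move=> _ /mapP[z zs ->]; apply/fintype.subsetP => v /setIP[vx vz].
  have [_ conv _] := bag_tree v.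
  (* Separation with the listed nodes as [A] and the nodes whose bag contains [v] as [B]; both
     contain [z]. *)
  suff: y \in [set t | v \in bag t] by rewrite inE.
  by apply: (tree_separation adj_sym tree cs conv xs ys xy (s := z)); rewrite inE.
- have -> : [set t in x :: s] = x |: [set t in s].
    by apply/setP => t; rewrite !inE.
  exact: (induced_connect_grow adj_sym cs ys).
Qed.

End RunningIntersection.

(** * Building a join tree along an elimination order *)

Section JoinTree.
Variables (V D : finType) (I : csp V D).

(** The set of variables shared between the constraints below [j] and the others; it contains the
    scope of [cproj I j]. *)
Definition boundary (j : join_tree V D) : {set V} :=
  [set v in outer_vars I j | has (fun c => v \in scope c) (leaves j)].

Lemma outer_varsS (j j' : join_tree V D) :
  {subset leaves j <= leaves j'} -> outer_vars I j' \subset outer_vars I j.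
Proof.
move=> jj'; apply/fintype.subsetP => v; rewrite !inE.
apply: sub_has => c /andP[cj' ->]; rewrite andbT.
by apply: contra cj'; exact: jj'.
Qed.

Lemma in_boundary (j : join_tree V D) v :
  (v \in boundary j) =
  (v \in outer_vars I j) && has (fun c => v \in scope c) (leaves j).
Proof. by rewrite finset.in_set. Qed.

Lemma scope_cproj (j : join_tree V D) : {subset scope (cproj I j) <= boundary j}.
Proof.
elim: j => [c|j1 IH1 j2 IH2] v; rewrite mem_filter in_boundary => /andP[-> /=].
  by rewrite orbF.
rewrite has_cat mem_cat => /orP[/IH1|].
  by rewrite in_boundary => /andP[_ ->].
by rewrite mem_filter => /andP[_ /IH2]; rewrite in_boundary orbC => /andP[_ ->].
Qed.

Lemma boundary_node (j1 j2 : join_tree V D) :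
  boundary (JNode j1 j2) \subset boundary j1 :|: boundary j2.
Proof.
apply/fintype.subsetP => v; rewrite finset.in_setU !in_boundary /= has_cat.
case/andP=> vo /orP[] vj; rewrite vj !andbT; apply/orP; [left|right];
  by apply: (fintype.subsetP (outer_varsS _) _ vo) => c; rewrite mem_cat => ->; rewrite ?orbT.
Qed.

Definition inside (s : seq {set V}) (j : join_tree V D) : bool :=
  has (fun B : {set V} => boundary j \subset B) s.

Definition covered (bags : seq {set V}) (J : join_tree V D) : bool :=
  all (inside bags) (nodes J).

Definition forest_leaves (F : seq (join_tree V D)) : seq (constraint V D) :=
  flatten [seq leaves j | j <- F].

Lemma mem_forest_leaves (F : seq (join_tree V D)) (P : pred (join_tree V D)) c :
  all P F -> c \in forest_leaves F ->
  exists j, [/\ P j, c \in leaves j & {subset leaves j <= forest_leaves F}].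
Proof.
elim: F => //= j F IHF /andP[Pj PF]; rewrite mem_cat => /orP[cj|/(IHF PF)].
  by exists j; split=> // c'; rewrite mem_cat => ->.
case=> j' [Pj' cj' sub]; exists j'; split=> // c' /sub.
by rewrite mem_cat orbC => ->.
Qed.

Lemma forest_leaves_filterC (a : pred (join_tree V D)) F :
  perm_eq (forest_leaves F)
    (forest_leaves [seq j <- F | a j] ++ forest_leaves [seq j <- F | ~~ a j]).
Proof.
elim: F => //= j F IHF; rewrite {1}/forest_leaves /=.
case: (a j) => /=; first by rewrite -catA perm_cat2l.
by rewrite perm_sym perm_catCA perm_cat2l perm_sym.
Qed.

(** The trees are joined in a comb; by [boundary_node] every new node keeps its boundary inside
    [X]. *)
Lemma merge_at_bag (bags : seq {set V}) (X : {set V}) F :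
  X \in bags -> F <> [::] -> all (covered bags) F ->
  all (fun j => boundary j \subset X) F ->
  exists J, [/\ leaves J = forest_leaves F, covered bags J & boundary J \subset X].
Proof.
move=> Xb; elim: F => // j [|j' F] IHF _.
  by case/andP=> cj _ /andP[jX _]; exists j; rewrite /forest_leaves /= cats0.
case/andP=> cj cF /andP[jX FX]; have [//|||J [lJ cJ JX]] := IHF; [by []..|].
have bX : boundary (JNode j J) \subset X.
  by apply: fintype.subset_trans (boundary_node _ _) _; rewrite finset.subUset jX.
exists (JNode j J); split=> //; first by rewrite /= lJ.
rewrite /covered /= all_cat -/(covered bags j) -/(covered bags J) cj cJ !andbT.
by apply/hasP; exists X.
Qed.

(** Induction on the bags [s] not yet eliminated. Roots must fit a bag of [s], whereas inner nodes
    only need one of the original [bags], so finished subtrees survive the elimination. *)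
Lemma merge_forest (bags s : seq {set V}) F :
  running_intersection s -> {subset s <= bags} -> F <> [::] ->
  perm_eq (forest_leaves F) (constraints I) ->
  all (covered bags) F -> all (inside s) F ->
  exists J, perm_eq (leaves J) (constraints I) /\ covered bags J.
Proof.
elim: s F => [|X s IHs] F /= ris sb F0 pF cF iF; first by case: F F0 iF pF cF.
case: ris => ris nextX.
(* [F1] holds the trees that fit no later bag, hence fit [X]; they are merged into [J1], which
   replaces them. *)
pose a := inside s; pose F1 := [seq j <- F | ~~ a j]; pose F2 := [seq j <- F | a j].
have pF12 : perm_eq (forest_leaves F2 ++ forest_leaves F1) (constraints I).
  by rewrite -(permPl (forest_leaves_filterC a F)).
have cF1 : all (covered bags) F1 by rewrite all_filter; apply: sub_all cF => j cj; apply/implyP.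
have cF2 : all (covered bags) F2 by rewrite all_filter; apply: sub_all cF => j cj; apply/implyP.
have aF2 : all a F2 by exact: filter_all.
have sb' : {subset s <= bags} by move=> Z Zs; apply: sb; rewrite inE Zs orbT.
have Xb : X \in bags by apply: sb; rewrite mem_head.
have XF1 : all (fun j => boundary j \subset X) F1.
  rewrite all_filter; apply: sub_all iF => j /= /orP[jX|]; first exact/implyP.
  by rewrite /a /inside => ->.
have [allF|] := boolP (all a F); first exact: IHs allF.
rewrite -has_predC has_count -size_filter -/F1 => F1_gt0.
have F1_0 : F1 <> [::] by move=> F1_0; rewrite F1_0 in F1_gt0.
have [J1 [lJ1 cJ1 J1X]] := merge_at_bag Xb F1_0 cF1 XF1.
have F2_nil_or : F2 = [::] \/ F2 <> [::] by case: (F2); [left|right].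
case: F2_nil_or => [F2_0|F2_0].
  by exists J1; split=> //; rewrite lJ1; move: pF12; rewrite F2_0.
have [Z0 Z0s] : exists Z, Z \in s.
  case: (F2) F2_0 aF2 => // j ? _ /= /andP[/hasP[Z Zs _] _].
  by exists Z.
case: nextX => [s0|[Y Ys XsY]]; first by rewrite s0 in Z0s.
have uF : uniq (forest_leaves F2 ++ forest_leaves F1).
  by rewrite (perm_uniq pF12) fset_uniq.
(* A boundary variable [v] of [J1] lies in [X] and also occurs in some tree [j] of [F2]. It is in
   the boundary of [j] too, because [c] lies in [J1] and thus outside [j]. So [v] is in [X] and in a
   later bag [Z], hence in [Y]. *)
have J1Y : boundary J1 \subset Y.
  apply/fintype.subsetP => v vJ1; have vX := fintype.subsetP J1X _ vJ1.
  move: vJ1; rewrite in_boundary inE => /andP[/hasP[c' c'I /andP[c'J1 vc']]].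
  case/hasP=> c cJ vc; rewrite lJ1 in cJ c'J1.
  have : c' \in forest_leaves F2 ++ forest_leaves F1 by rewrite (perm_mem pF12).
  rewrite mem_cat (negbTE c'J1) orbF => c'F2.
  have [j [/hasP[Z Zs jZ] c'j jF2]] := mem_forest_leaves aF2 c'F2.
  apply: (fintype.subsetP (XsY _ Zs)); rewrite finset.in_setI vX.
  apply: (fintype.subsetP jZ); rewrite in_boundary.
  apply/andP; split; last by apply/hasP; exists c'.
  rewrite inE; apply/hasP; exists c.
    by rewrite -(perm_mem pF12) mem_cat cJ orbT.
  rewrite vc andbT; apply/negP => /jF2 cF2'.
  by move: uF; rewrite cat_uniq => /and3P[_ /hasPn/(_ _ cJ)/negP].
apply: (IHs (J1 :: F2)) => //=.
- rewrite /forest_leaves /= lJ1; apply: perm_trans pF12; rewrite perm_catC.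
  exact: perm_refl.
- by rewrite cJ1.
- by rewrite aF2 andbT; apply/hasP; exists Y.
Qed.

End JoinTree.

(** * From a fractional hypertree decomposition to a join decomposition of no larger width *)

Lemma decomposition_of_fhd (R : realType) (V D : finType) (I : csp V D)
    (d : fhd R (hyperedges I)) :
  (exists c, c \in constraints I) ->
  exists2 J, join_decomposition I J &
    all (fun j => [exists t, boundary I j \subset fhd_bag (f := d) t]) (nodes J).
Proof.
move=> [c0 c0I].
have [s [rs sT]] := tree_running_intersection (@fhd_adj_sym _ _ _ d)
  (fhd_tree d) (fhd_vertex d).
pose bags := [seq fhd_bag t | t <- s].
have leaf_inside c : c \in constraints I -> inside I bags (JLeaf c).
  move=> cI; have [|t ct] := fhd_edge d (e := scope_set c).
    by rewrite inE; apply/hasP; exists c.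
  apply/hasP; exists (fhd_bag t); first by rewrite map_f.
  apply: fintype.subset_trans ct; apply/fintype.subsetP => v.
  by rewrite in_boundary /= orbF => /andP[_ vc]; rewrite inE.
(* The initial forest has one single-leaf tree per constraint, each fitting a bag that contains its
   scope. *)
pose F := [seq JLeaf c | c <- constraints I].
have leaves_inside : all (inside I bags) F.
  by rewrite all_map; apply/allP => c cI; exact: leaf_inside.
have F_leaves : forest_leaves F = constraints I.
  by rewrite /F /forest_leaves; elim: (enum_fset _) => //= c l ->.
have [|||||J [Jp Jc]] := @merge_forest _ _ I bags bags F rs.
- by move=> Z.
- move=> F0; suff: c0 \in forest_leaves F by rewrite F0.
  by rewrite F_leaves.
- by rewrite F_leaves perm_refl.
- rewrite /F all_map; apply/allP => c cI.
  by rewrite /= /covered /= leaf_inside.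
- exact: leaves_inside.
exists J.
  by split; [rewrite (perm_uniq Jp) fset_uniq | exact: perm_mem].
apply: sub_all Jc => j /hasP[_ /mapP[t _ ->] jt].
by apply/existsP; exists t.
Qed.

Theorem theorem13 (R : realType) (V D : finType) (I : csp V D)
    (I_nonempty : exists c, c \in constraints I) :
  (joinwidth R I <= fhtw R I)%E.
Proof.
apply/ereal_infP => _ [d <-].
have [J JI /all_nthP Jbag] := decomposition_of_fhd d I_nonempty.
apply: ge_ereal_inf; exists (decomposition_joinwidth R I J); first by exists J.
rewrite /decomposition_joinwidth (big_nth J) big_mkord.
apply/bigmax_leP; split=> [|i _]; first exact: leNye.
have /existsP[t jt] := Jbag J _ (ltn_ord i).
apply: le_trans (le_bigmax _ _ t).
(* The weight of the cover at [t], whose bag contains the boundary of the node, is an admissible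
   exponent for its joinwidth. *)
apply: ge_ereal_inf; exists (\sum_(e in hyperedges I) fhd_cover t e)%:E => //.
exists (\sum_(e in hyperedges I) fhd_cover t e) => //=.
apply: card_prune_le => // [e|v vj]; first exact: fhd_cover_ge0.
exact/fhd_coverP/(fintype.subsetP jt)/scope_cproj.
Qed.
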